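(* Assume that $\sqrt3/2<p<1$. Let $(\varphi_0,\varphi_1,\varphi_2)$ be the solution of the system $$\varphi_0''=-\Lambda\varphi_0,\qquad \varphi_1''=(1-\Lambda)\varphi_1,\qquad \varphi_2''=(4-\Lambda)\varphi_2,\qquad \Lambda=2(\varphi_1^2+4\varphi_2^2),$$ with initial conditions $$\varphi_0(0)=\sqrt{1-p^2},\ \varphi_0'(0)=0,\quad \varphi_1(0)=0,\ \varphi_1'(0)=2p,\quad \varphi_2(0)=p,\ \varphi_2'(0)=0.$$ Then $(\varphi_0,\varphi_1,\varphi_2)$ is not a periodic solution satisfying Condition A.
   Context: Here $\Lambda$ plays the role of $\lambda f$, where $\lambda$ is an eigenvalue and $f$ a conformal factor. The solution satisfies $\varphi_0^2+\varphi_1^2+\varphi_2^2=1$ and $(\varphi_0')^2+(\varphi_1')^2+(\varphi_2')^2=\varphi_1^2+4\varphi_2^2$; moreover $\varphi_0,\varphi_2$ are even and $\varphi_1$ is odd. A periodic solution with period $a>0$ is one for which $\varphi_0,\varphi_1,\varphi_2$ are all periodic with period $a$. Condition A (zeros): $\varphi_0$ and $\varphi_1$ each have exactly two zeros in the period $[0,a)$, while $\varphi_2$ does not vanish. *)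

(* Defs.v *)
From Stdlib Require Import Reals.
From Coquelicot Require Import Coquelicot.
Open Scope R_scope.

(* [phi'' = q * phi] on the whole line.  [Derive] is total with a junk value at
   points of non-differentiability, so differentiability of [phi] itself has to
   be required separately. *)
Definition solves_second_order (q phi : R -> R) : Prop :=
  forall x : R, ex_derive phi x /\ is_derive (Derive phi) x (q x * phi x).

Definition Lambda (phi1 phi2 : R -> R) (x : R) : R :=
  2 * (phi1 x ^ 2 + 4 * phi2 x ^ 2).

Record solves_system (phi0 phi1 phi2 : R -> R) : Prop := {
  eq_phi0 : solves_second_order (fun x => - Lambda phi1 phi2 x) phi0;
  eq_phi1 : solves_second_order (fun x => 1 - Lambda phi1 phi2 x) phi1;
  eq_phi2 : solves_second_order (fun x => 4 - Lambda phi1 phi2 x) phi2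
}.

Record initial_conditions (p : R) (phi0 phi1 phi2 : R -> R) : Prop := {
  init_phi0 : phi0 0 = sqrt (1 - p ^ 2);
  init_dphi0 : Derive phi0 0 = 0;
  init_phi1 : phi1 0 = 0;
  init_dphi1 : Derive phi1 0 = 2 * p;
  init_phi2 : phi2 0 = p;
  init_dphi2 : Derive phi2 0 = 0
}.

(* [a] need not be the least period. *)
Definition has_period (a : R) (phi : R -> R) : Prop :=
  forall x : R, phi (x + a) = phi x.

Definition exactly_two_zeros (a : R) (phi : R -> R) : Prop :=
  exists x y : R,
    x <> y /\
    (forall z : R, (0 <= z < a /\ phi z = 0) <-> (z = x \/ z = y)).

Definition periodic_solution (a : R) (phi0 phi1 phi2 : R -> R) : Prop :=
  solves_system phi0 phi1 phi2 /\
  has_period a phi0 /\ has_period a phi1 /\ has_period a phi2.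

Definition condition_A (a : R) (phi0 phi1 phi2 : R -> R) : Prop :=
  exactly_two_zeros a phi0 /\ exactly_two_zeros a phi1 /\
  (forall x : R, phi2 x <> 0).

(* Main.v *)
Require Import Defs.
From Stdlib Require Import Reals Lra Psatz.
From Coquelicot Require Import Coquelicot.
Open Scope R_scope.

(** Let [v x] be the larger of the two elliptic coordinates of the point
    [(phi0, phi1, phi2)] of the unit sphere, i.e. the larger root [z] of
    [phi0^2/z + phi1^2/(z-1) + phi2^2/(z-4) = 0].  It lies in [[1, 4]], and equals 4
    only where [phi2 = 0].  If [phi2] never vanishes, the periodic function [v] has a
    maximum [z] in [(1, 4)].  At such a critical point the first integral
    [spectral_form z] of the (Neumann) system vanishes; but the initial conditions give
    it the value [(z - 4 (1 - p^2)) (z - 1 - 4 p^2)], whose roots are outside [(1, 4)]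
    when [p^2 > 3/4]. *)

(* [auto_derive] leaves [Derive (fun x => f x)], which neither [ring] nor [rewrite]
   identifies with [Derive f]. *)
Ltac eta_derive :=
  repeat match goal with
  | |- context [Derive (fun x : R => ?f x)] =>
      progress change (Derive (fun x : R => f x)) with (Derive f)
  end.

(** * Gronwall inequality with zero initial value *)

(** [N x * exp (- C * x)] starts at 0 and has nonpositive derivative on [[0, r]], so it is at most 0
    there. *)
Lemma gronwall_zero_right (N dN : R -> R) (C r : R) :
  (forall x, is_derive N x (dN x)) -> (forall x, 0 <= N x) -> N 0 = 0 ->
  (forall x, 0 <= x <= r -> dN x <= C * N x) ->
  forall x, 0 <= x <= r -> N x = 0.
Proof.
intros HN Hpos H0 Hle x Hx.
destruct (MVT_gen (fun t => N t * exp (- C * t)) 0 x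
  (fun t => (dN t - C * N t) * exp (- C * t))) as [c [Hc Heq]].
- intros t _.
  auto_derive; [now exists (dN t)|].
  eta_derive; rewrite (is_derive_unique _ _ _ (HN t)); ring.
- intros t _.
  apply continuity_pt_filterlim, (ex_derive_continuous (fun t => N t * exp (- C * t))).
  auto_derive; now exists (dN t).
- rewrite Rmin_left, Rmax_right in Hc by lra.
  rewrite H0, Rmult_0_l, !Rminus_0_r in Heq.
  assert (Hd : dN c - C * N c <= 0) by (specialize (Hle c); lra).
  assert (He1 := exp_pos (- C * c)).
  assert (He2 := exp_pos (- C * x)).
  assert (Hp : 0 <= N x * exp (- C * x)) by (specialize (Hpos x); nra).
  assert (Hn : N x * exp (- C * x) <= 0).
  { rewrite Heq.
    assert ((dN c - C * N c) * exp (- C * c) <= 0) by nra.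
    nra. }
  specialize (Hpos x); nra.
Qed.

(** The bound on [Rabs (dN x)] is invariant under [x -> - x], so the left half reduces to the right
    one. *)
Lemma gronwall_zero (N dN : R -> R) (C r : R) :
  (forall x, is_derive N x (dN x)) -> (forall x, 0 <= N x) -> N 0 = 0 ->
  (forall x, - r <= x <= r -> Rabs (dN x) <= C * N x) ->
  forall x, - r <= x <= r -> N x = 0.
Proof.
intros HN Hpos H0 Hle x Hx.
destruct (Rle_dec 0 x) as [Hx0|Hx0].
- apply (gronwall_zero_right N dN C r); [exact HN|exact Hpos|exact H0| |lra].
  intros y Hy; eapply Rle_trans; [apply Rle_abs|apply Hle; lra].
- rewrite <- (Ropp_involutive x).
  apply (gronwall_zero_right (fun y => N (- y)) (fun y => - dN (- y)) C r);
    [| now intros | now rewrite Ropp_0 | | lra].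
  + intros y; auto_derive; [now exists (dN (- y))|].
    eta_derive; rewrite (is_derive_unique _ _ _ (HN (- y))); ring.
  + intros y Hy; assert (Hb := Hle (- y)); assert (Hm := Rle_abs (- dN (- y))).
    rewrite Rabs_Ropp in Hm; lra.
Qed.

Lemma solves_second_order_derive (q phi : R -> R) (x : R) :
  solves_second_order q phi -> is_derive phi x (Derive phi x).
Proof. intros H; apply Derive_correct, H. Qed.

Lemma derive_zero_local_min (g : R -> R) (x l a b : R) :
  is_derive g x l -> a < x < b -> (forall y, a < y < b -> g x <= g y) -> l = 0.
Proof.
intros Hg Hx Hmin.
assert (pr : derivable_pt g x) by (exists l; now apply is_derive_Reals).
rewrite <- (is_derive_unique _ _ _ Hg), <- (Derive_Reals _ _ pr).
apply (deriv_minimum g a b x pr); try tauto; intros y Hy1 Hy2; apply Hmin; lra.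
Qed.

(** * Invariance of the unit sphere *)

(** Inside [Rabs] stands the derivative of [s^2 + t^2 + e^2] when [s' = t], [t' = 2 e - 2 l s],
    [e' = - l t]. Applying [2 |u w| <= u^2 + w^2] to each product gives the coefficients [1 + 2 l],
    [3 + 3 l], [2 + l]; the largest one yields the constant. *)
Lemma lyapunov_bound (l m s t e : R) :
  0 <= l -> l <= m ->
  Rabs (2 * s * t + 2 * t * (2 * e - 2 * l * s) + 2 * e * (- l * t))
    <= (3 + 3 * m) * (s ^ 2 + t ^ 2 + e ^ 2).
Proof.
intros Hl Hm; assert (Hml : 0 <= m - l) by lra.
assert (Hsq : forall u k, 0 <= k -> 0 <= k * u ^ 2)
  by (intros u k Hk; apply Rmult_le_pos; [exact Hk|apply pow2_ge_0]).
assert (Xs := Hsq s _ Hml); assert (Xt := Hsq t _ Hml); assert (Xe := Hsq e _ Hml).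
assert (Ys := Hsq s l Hl); assert (Yt := Hsq t l Hl); assert (Ye := Hsq e l Hl).
assert (Z1 := Hsq (s + t) l Hl); assert (Z2 := Hsq (s - t) l Hl).
assert (Z3 := Hsq (e + t) l Hl); assert (Z4 := Hsq (e - t) l Hl).
assert (Ws := pow2_ge_0 (s + t)); assert (Wt := pow2_ge_0 (s - t)).
assert (Vs := pow2_ge_0 (e + t)); assert (Vt := pow2_ge_0 (e - t)).
assert (Us := pow2_ge_0 s); assert (Ue := pow2_ge_0 e).
apply Rabs_le; split; lra.
Qed.

Definition speed_excess (phi0 phi1 phi2 : R -> R) (x : R) : R :=
  Derive phi0 x ^ 2 + Derive phi1 x ^ 2 + Derive phi2 x ^ 2
    - phi1 x ^ 2 - 4 * phi2 x ^ 2.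

(* With [s = phi0^2 + phi1^2 + phi2^2 - 1] and [e] the speed excess, the triple
   [(s, s', e)] solves the linear system [s'' = 2 e - 2 Lambda s], [e' = - Lambda s']
   with zero initial data. *)
Lemma solution_on_sphere (phi0 phi1 phi2 : R -> R) :
  solves_system phi0 phi1 phi2 ->
  phi0 0 ^ 2 + phi1 0 ^ 2 + phi2 0 ^ 2 = 1 ->
  phi0 0 * Derive phi0 0 + phi1 0 * Derive phi1 0 + phi2 0 * Derive phi2 0 = 0 ->
  speed_excess phi0 phi1 phi2 0 = 0 ->
  forall x, phi0 x ^ 2 + phi1 x ^ 2 + phi2 x ^ 2 = 1.
Proof.
intros [H0 H1 H2] Is It Ie x.
assert (D0 := fun y => solves_second_order_derive _ _ y H0).
assert (D1 := fun y => solves_second_order_derive _ _ y H1).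
assert (D2 := fun y => solves_second_order_derive _ _ y H2).
set (L := Lambda phi1 phi2).
set (s := fun y => phi0 y ^ 2 + phi1 y ^ 2 + phi2 y ^ 2 - 1).
set (t := fun y => 2 * (phi0 y * Derive phi0 y + phi1 y * Derive phi1 y
                        + phi2 y * Derive phi2 y)).
set (e := speed_excess phi0 phi1 phi2).
assert (Hs : forall y, is_derive s y (t y)).
{ intros y; unfold s, t; auto_derive.
  - repeat split; eexists; eauto.
  - eta_derive; ring. }
assert (E0 := fun y => proj2 (H0 y)).
assert (E1 := fun y => proj2 (H1 y)).
assert (E2 := fun y => proj2 (H2 y)).
assert (Ht : forall y, is_derive t y (2 * e y - 2 * L y * s y)).
{ intros y; unfold t; auto_derive.
  - repeat split; eexists; eauto.
  - eta_derive; rewrite (is_derive_unique _ _ _ (E0 y)), (is_derive_unique _ _ _ (E1 y)),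
      (is_derive_unique _ _ _ (E2 y)).
    unfold e, speed_excess, L, s, Lambda; ring. }
assert (He : forall y, is_derive e y (- L y * t y)).
{ intros y; unfold e, speed_excess; auto_derive.
  - repeat split; eexists; eauto.
  - eta_derive; rewrite (is_derive_unique _ _ _ (E0 y)), (is_derive_unique _ _ _ (E1 y)),
      (is_derive_unique _ _ _ (E2 y)).
    unfold t, L, Lambda; ring. }
set (r := Rabs x).
assert (Hr : 0 <= r) by apply Rabs_pos.
(* No global bound on [Lambda] is known before the sphere is, so its maximum over [[- r, r]]
   provides the Gronwall constant for this [x]. *)
destruct (continuity_ab_maj L (- r) r) as [m [Hm _]]; [lra| |].
{ intros y _; apply continuity_pt_filterlim, (ex_derive_continuous L).
  unfold L, Lambda; auto_derive; repeat split; eexists; eauto. }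
set (N := fun y => s y ^ 2 + t y ^ 2 + e y ^ 2).
assert (HN : N x = 0).
{ apply (gronwall_zero N
    (fun y => 2 * s y * t y + 2 * t y * (2 * e y - 2 * L y * s y)
              + 2 * e y * (- L y * t y)) (3 + 3 * L m) r).
  - intros y; unfold N; clearbody s t e.
    auto_derive; [repeat split; eexists; eauto|].
    eta_derive; rewrite (is_derive_unique _ _ _ (Hs y)), (is_derive_unique _ _ _ (Ht y)),
      (is_derive_unique _ _ _ (He y)); ring.
  - intros y; unfold N; nra.
  - unfold N, s, t, e; rewrite Is, It, Ie; ring.
  - intros y Hy.
    assert (HM := Hm y Hy).
    assert (HL : 0 <= L y) by (unfold L, Lambda; nra).
    apply lyapunov_bound; [exact HL|exact HM].
  - apply Rabs_le_between, Rle_refl. }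
assert (Hsx : s x = 0) by (unfold N in HN; nra).
unfold s in Hsx; lra.
Qed.

(** * First integrals of the Neumann system *)

(** Denominators are cleared so that the poles 1 and 4 may be substituted for [z]. *)
Definition conic_form (z a b c : R) : R :=
  a ^ 2 * (z - 1) * (z - 4) + b ^ 2 * z * (z - 4) + c ^ 2 * z * (z - 1).

(** Up to the factor [z (z - 1) (z - 4)], the generating function of the Uhlenbeck integrals. *)
Definition spectral_form (phi0 phi1 phi2 : R -> R) (z x : R) : R :=
  conic_form z (phi0 x) (phi1 x) (phi2 x)
  - ((phi0 x * Derive phi1 x - phi1 x * Derive phi0 x) ^ 2 * (z - 4)
     + (phi0 x * Derive phi2 x - phi2 x * Derive phi0 x) ^ 2 * (z - 1)
     + (phi1 x * Derive phi2 x - phi2 x * Derive phi1 x) ^ 2 * z).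

Lemma spectral_form_conserved (phi0 phi1 phi2 : R -> R) (z x : R) :
  solves_system phi0 phi1 phi2 ->
  (forall y, phi0 y ^ 2 + phi1 y ^ 2 + phi2 y ^ 2 = 1) ->
  spectral_form phi0 phi1 phi2 z x = spectral_form phi0 phi1 phi2 z 0.
Proof.
intros [H0 H1 H2] HS.
assert (D0 := fun y => solves_second_order_derive _ _ y H0).
assert (D1 := fun y => solves_second_order_derive _ _ y H1).
assert (D2 := fun y => solves_second_order_derive _ _ y H2).
assert (E0 := fun y => proj2 (H0 y)).
assert (E1 := fun y => proj2 (H1 y)).
assert (E2 := fun y => proj2 (H2 y)).
assert (HT : forall y, phi0 y * Derive phi0 y + phi1 y * Derive phi1 y
                       + phi2 y * Derive phi2 y = 0).
{ intros y.
  assert (Hd : is_derive (fun y => phi0 y ^ 2 + phi1 y ^ 2 + phi2 y ^ 2) y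
    (2 * (phi0 y * Derive phi0 y + phi1 y * Derive phi1 y + phi2 y * Derive phi2 y))).
  { auto_derive; [repeat split; eexists; eauto|eta_derive; ring]. }
  apply is_derive_unique in Hd.
  rewrite (Derive_ext _ (fun _ => 1)), Derive_const in Hd by exact HS; lra. }
assert (HW : forall y, is_derive (spectral_form phi0 phi1 phi2 z) y 0).
{ intros y; unfold spectral_form, conic_form; auto_derive.
  - repeat split; eexists; eauto.
  - eta_derive; rewrite (is_derive_unique _ _ _ (E0 y)), (is_derive_unique _ _ _ (E1 y)),
      (is_derive_unique _ _ _ (E2 y)).
    (* Each summand has a factor that vanishes on the sphere: [1 - |phi|^2] or the inner product of
       [phi] and [phi']. *)
    transitivity
     (2 * (phi0 y * Derive phi0 y * (z - 1) * (z - 4) + phi1 y * Derive phi1 y * z * (z - 4)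
           + phi2 y * Derive phi2 y * z * (z - 1))
        * (1 - (phi0 y ^ 2 + phi1 y ^ 2 + phi2 y ^ 2))
      + 2 * conic_form z (phi0 y) (phi1 y) (phi2 y)
        * (phi0 y * Derive phi0 y + phi1 y * Derive phi1 y + phi2 y * Derive phi2 y)).
    + unfold conic_form, Lambda; ring.
    + rewrite HS, HT; ring. }
destruct (MVT_gen (spectral_form phi0 phi1 phi2 z) 0 x (fun _ => 0)) as [c [_ Hc]].
- intros y _; apply HW.
- intros y _; apply continuity_pt_filterlim,
    (ex_derive_continuous (spectral_form phi0 phi1 phi2 z)); eexists; apply HW.
- lra.
Qed.

(* Lagrange's identity: up to the factor [z (z - 1) (z - 4)], the spectral form is
   [K (1 - K') + B ^ 2] with [K], [K'], [B] the forms [sum q q / (z - lambda)] in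
   [(phi, phi)], [(phi', phi')], [(phi, phi')]. *)
Lemma conic_critical_point (z a b c a' b' c' : R) :
  1 < z < 4 ->
  conic_form z a b c = 0 ->
  a * a' * (z - 1) * (z - 4) + b * b' * z * (z - 4) + c * c' * z * (z - 1) = 0 ->
  (a * b' - b * a') ^ 2 * (z - 4) + (a * c' - c * a') ^ 2 * (z - 1)
    + (b * c' - c * b') ^ 2 * z = 0.
Proof.
intros Hz HK HB.
apply (Rmult_eq_reg_l (z * (z - 1) * (z - 4))).
- transitivity (conic_form z a b c * conic_form z a' b' c'
    - (a * a' * (z - 1) * (z - 4) + b * b' * z * (z - 4) + c * c' * z * (z - 1)) ^ 2).
  + unfold conic_form; ring.
  + rewrite HK, HB; ring.
- repeat apply Rmult_integral_contrapositive_currified; lra.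
Qed.

(** * The larger elliptic coordinate *)

(** On the unit sphere this is the sum of the roots of [conic_form]; their product is [4 a^2]. *)
Definition elliptic_trace (a b c : R) : R := 5 * a ^ 2 + 4 * b ^ 2 + c ^ 2.

Definition elliptic_coord (a b c : R) : R :=
  (elliptic_trace a b c + sqrt (elliptic_trace a b c ^ 2 - 16 * a ^ 2)) / 2.

(** The two sides differ by [12 b^2]. This makes the roots real, and taking square roots puts the
    larger one at 1 or above. *)
Lemma elliptic_discr (a b c : R) :
  a ^ 2 + b ^ 2 + c ^ 2 = 1 ->
  (elliptic_trace a b c - 2) ^ 2 <= elliptic_trace a b c ^ 2 - 16 * a ^ 2.
Proof. unfold elliptic_trace; intros H; nra. Qed.

Lemma conic_form_elliptic (a b c z : R) :
  a ^ 2 + b ^ 2 + c ^ 2 = 1 ->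
  conic_form z a b c =
    (z - elliptic_coord a b c)
    * (z - (elliptic_trace a b c - elliptic_coord a b c)).
Proof.
intros H.
assert (Hd := elliptic_discr a b c H).
assert (Hq : sqrt (elliptic_trace a b c ^ 2 - 16 * a ^ 2) ^ 2
             = elliptic_trace a b c ^ 2 - 16 * a ^ 2)
  by (eapply pow2_sqrt, Rle_trans; [apply pow2_ge_0|exact Hd]).
unfold elliptic_coord.
transitivity (z ^ 2 * (a ^ 2 + b ^ 2 + c ^ 2) - elliptic_trace a b c * z + 4 * a ^ 2).
- unfold conic_form, elliptic_trace; ring.
- rewrite H; revert Hq; generalize (sqrt (elliptic_trace a b c ^ 2 - 16 * a ^ 2)).
  intros q Hq.
  replace (4 * a ^ 2) with ((elliptic_trace a b c ^ 2 - q ^ 2) / 4) by lra; field.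
Qed.

Lemma elliptic_coord_half_trace (a b c : R) :
  elliptic_trace a b c <= 2 * elliptic_coord a b c.
Proof.
unfold elliptic_coord.
assert (H := sqrt_pos (elliptic_trace a b c ^ 2 - 16 * a ^ 2)); lra.
Qed.

Lemma elliptic_coord_ge_1 (a b c : R) :
  a ^ 2 + b ^ 2 + c ^ 2 = 1 -> 1 <= elliptic_coord a b c.
Proof.
intros H.
assert (Hd := sqrt_le_1_alt _ _ (elliptic_discr a b c H)).
replace ((elliptic_trace a b c - 2) ^ 2) with (Rsqr (elliptic_trace a b c - 2)) in Hd
  by (unfold Rsqr; ring).
rewrite sqrt_Rsqr_abs in Hd.
assert (Ha := Rle_abs (- (elliptic_trace a b c - 2))).
rewrite Rabs_Ropp in Ha; unfold elliptic_coord; lra.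
Qed.

(** At 4 the form equals [12 c^2 > 0], so 4 is not between the roots; their sum is at most 5, so 4
    is not below both. *)
Lemma elliptic_coord_lt_4 (a b c : R) :
  a ^ 2 + b ^ 2 + c ^ 2 = 1 -> c <> 0 -> elliptic_coord a b c < 4.
Proof.
intros H Hc.
assert (HG := conic_form_elliptic a b c 4 H).
assert (Hh := elliptic_coord_half_trace a b c).
assert (Hs : elliptic_trace a b c <= 5) by (unfold elliptic_trace; nra).
assert (Hc2 : 0 < c ^ 2) by (apply pow2_gt_0; exact Hc).
assert (HG4 : 0 < conic_form 4 a b c) by (unfold conic_form; nra).
apply Rnot_le_lt; intros H4; nra.
Qed.

(** At 1 the form equals [- 3 b^2]. *)
Lemma elliptic_coord_eq_1 (a b c : R) :
  a ^ 2 + b ^ 2 + c ^ 2 = 1 -> elliptic_coord a b c = 1 -> b = 0.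
Proof.
intros H H1.
assert (HG := conic_form_elliptic a b c 1 H).
rewrite H1 in HG; unfold conic_form in HG; nra.
Qed.

(** Turns a maximum [z] of the coordinate into a minimum of [conic_form z] along the solution. The
    polynomial is then differentiated instead of [elliptic_coord], whose square root may fail to be
    smooth. *)
Lemma conic_form_nonneg (a b c z : R) :
  a ^ 2 + b ^ 2 + c ^ 2 = 1 -> elliptic_coord a b c <= z -> 0 <= conic_form z a b c.
Proof.
intros H Hz.
rewrite (conic_form_elliptic a b c z H).
assert (Hh := elliptic_coord_half_trace a b c).
apply Rmult_le_pos; lra.
Qed.

(** * The maximum over a period and the contradiction *)

(** The comparison reaches over the adjacent periods so that [x] is interior even when it is [0] or
    [a]. *)
Lemma periodic_local_max (f : R -> R) (a : R) :
  0 < a -> has_period a f -> (forall x, continuity_pt f x) ->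
  exists x, 0 <= x <= a /\ forall y, - a < y < 2 * a -> f y <= f x.
Proof.
intros Ha Hper Hcont.
destruct (continuity_ab_maj f 0 a) as [x [Hx Hx0]]; [lra|intros; apply Hcont|].
exists x; split; [exact Hx0|]; intros y Hy.
destruct (Rlt_dec y 0) as [H|H].
- rewrite <- (Hper y); apply Hx; lra.
- destruct (Rle_dec y a) as [H'|H'].
  + apply Hx; lra.
  + replace y with (y - a + a) by ring; rewrite Hper; apply Hx; lra.
Qed.

Lemma elliptic_coord_continuous (phi0 phi1 phi2 : R -> R) (x : R) :
  ex_derive phi0 x -> ex_derive phi1 x -> ex_derive phi2 x ->
  continuity_pt (fun y => elliptic_coord (phi0 y) (phi1 y) (phi2 y)) x.
Proof.
intros H0 H1 H2.
set (T := fun y => elliptic_trace (phi0 y) (phi1 y) (phi2 y)).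
assert (HT : ex_derive T x) by (unfold T, elliptic_trace; auto_derive; auto).
apply continuity_pt_filterlim.
apply (continuous_mult (fun y => T y + sqrt (T y ^ 2 - 16 * phi0 y ^ 2)) (fun _ => / 2));
  [|apply continuous_const].
apply (continuous_plus T (fun y => sqrt (T y ^ 2 - 16 * phi0 y ^ 2))).
- now apply (ex_derive_continuous T).
- apply (continuous_comp (fun y => T y ^ 2 - 16 * phi0 y ^ 2) sqrt).
  + apply (ex_derive_continuous (fun y => T y ^ 2 - 16 * phi0 y ^ 2)).
    clearbody T; auto_derive; auto.
  + apply continuous_sqrt.
Qed.

Theorem theorem5p2p1 (p : R) (hp : sqrt 3 / 2 < p < 1)
  (phi0 phi1 phi2 : R -> R)
  (hsys : solves_system phi0 phi1 phi2)
  (hinit : initial_conditions p phi0 phi1 phi2) :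
  ~ (exists a : R, 0 < a /\
       periodic_solution a phi0 phi1 phi2 /\ condition_A a phi0 phi1 phi2).
Proof.
intros [a [Ha [[_ [P0 [P1 P2]]] [_ [_ Hne]]]]].
destruct hinit as [I0 I0' I1 I1' I2 I2'].
assert (D0 := fun y => solves_second_order_derive _ _ y (eq_phi0 _ _ _ hsys)).
assert (D1 := fun y => solves_second_order_derive _ _ y (eq_phi1 _ _ _ hsys)).
assert (D2 := fun y => solves_second_order_derive _ _ y (eq_phi2 _ _ _ hsys)).
assert (Hp0 : 0 < p) by (assert (Hs3 := sqrt_pos 3); lra).
assert (Hp2 : 3 / 4 < p ^ 2).
{ assert (Hs3 := sqrt_pos 3); assert (Hq3 : sqrt 3 ^ 2 = 3) by (apply pow2_sqrt; lra).
  nra. }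
assert (I0sq : phi0 0 ^ 2 = 1 - p ^ 2) by (rewrite I0; apply pow2_sqrt; nra).
assert (HS : forall x, phi0 x ^ 2 + phi1 x ^ 2 + phi2 x ^ 2 = 1).
{ apply solution_on_sphere; [exact hsys| | |].
  - rewrite I0sq, I1, I2; ring.
  - rewrite I0', I1, I2'; ring.
  - unfold speed_excess; rewrite I0', I1', I2', I1, I2; ring. }
set (v := fun x => elliptic_coord (phi0 x) (phi1 x) (phi2 x)).
destruct (periodic_local_max v a) as [x0 [Hx0 Hmax]]; [exact Ha| | |].
{ intros x; unfold v; now rewrite P0, P1, P2. }
{ intros x; apply elliptic_coord_continuous; eexists; eauto. }
set (z := v x0) in *.
assert (Hz4 : z < 4) by (apply elliptic_coord_lt_4; auto).
assert (Hz1 : 1 < z).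
(* A maximum equal to 1 would force [phi1 = 0] near 0, against [phi1' (0) = 2 p > 0]. *)
{ destruct (elliptic_coord_ge_1 _ _ _ (HS x0)) as [H|H]; [exact H|exfalso].
  assert (Hv : forall y, - a < y < a -> phi1 y = 0).
  { intros y Hy.
    apply (elliptic_coord_eq_1 _ _ _ (HS y)), Rle_antisym.
    - rewrite H; apply Hmax; lra.
    - apply elliptic_coord_ge_1, HS. }
  assert (Hd : 2 * p = 0); [|lra].
  apply (derive_zero_local_min phi1 0 (2 * p) (- a) a).
  - rewrite <- I1'; apply D1.
  - lra.
  - intros y Hy; rewrite !Hv; lra. }
set (K := fun x => conic_form z (phi0 x) (phi1 x) (phi2 x)).
assert (HK0 : K x0 = 0).
{ unfold K; rewrite (conic_form_elliptic _ _ _ _ (HS x0)).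
  change (elliptic_coord (phi0 x0) (phi1 x0) (phi2 x0)) with z; ring. }
assert (HB : 2 * (phi0 x0 * Derive phi0 x0 * (z - 1) * (z - 4)
  + phi1 x0 * Derive phi1 x0 * z * (z - 4) + phi2 x0 * Derive phi2 x0 * z * (z - 1)) = 0).
{ apply (derive_zero_local_min K x0 _ (- a) (2 * a)); [|lra|].
  - unfold K, conic_form; clearbody z.
    auto_derive; [repeat split; eexists; eauto|eta_derive; ring].
  - intros y Hy; rewrite HK0; apply conic_form_nonneg; [apply HS|now apply Hmax]. }
assert (HW := spectral_form_conserved phi0 phi1 phi2 z x0 hsys HS).
unfold spectral_form in HW.
rewrite (conic_critical_point z (phi0 x0) (phi1 x0) (phi2 x0)) in HW;
  [|lra|exact HK0|lra].
change (conic_form z (phi0 x0) (phi1 x0) (phi2 x0)) with (K x0) in HW.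
rewrite HK0, I0', I1', I2', I1, I2 in HW.
(* At 0 the conic part is [(z - 1) (z - 4 (1 - p^2))] and the subtracted part is
   [4 p^2 (z - 4 (1 - p^2))]. *)
assert (HQ : (z - 4 * (1 - p ^ 2)) * (z - 1 - 4 * p ^ 2) = 0).
{ unfold conic_form in HW; ring_simplify in HW; rewrite I0sq in HW.
  rewrite HW; ring. }
apply Rmult_integral in HQ; lra.
Qed.
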